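(* The graph $R_{20}$ is Class 0, i.e. $\pi(R_{20})=20$.
   Context: $R_{20}$ is the graph on vertices $v_1,\dots,v_{20}$ whose adjacency lists (neighbors given by indices) are: $v_1$: 6,8,11,12,14,15,16,17; $v_2$: 4,5,6,7,8,10,15,16,17,18,19,20; $v_3$: 4,6,8,12,14,20; $v_4$: 2,3,5,6,8,9,12,15,18,19; $v_5$: 2,4,7,12,14,15,16,18,20; $v_6$: 1,2,3,4,7,8,14,15,19; $v_7$: 2,5,6,8,11,12,13,14,15,17,18; $v_8$: 1,2,3,4,6,7,10,11,14,15,17; $v_9$: 4,10,11,13,14,17,19,20; $v_{10}$: 2,8,9,16,18,19,20; $v_{11}$: 1,7,8,9,13,14,16,18,20; $v_{12}$: 1,3,4,5,7,13,16; $v_{13}$: 7,9,11,12,19,20; $v_{14}$: 1,3,5,6,7,8,9,11,18; $v_{15}$: 1,2,4,5,6,7,8,19; $v_{16}$: 1,2,5,10,11,12,18,20; $v_{17}$: 1,2,7,8,9,19; $v_{18}$: 2,4,5,7,10,11,14,16,20; $v_{19}$: 2,4,6,9,10,13,15,17,20; $v_{20}$: 2,3,5,9,10,11,13,16,18,19. A configuration on a connected graph $G$ is a function $C:V(G)\to\mathbb{N}$; a pebbling step from $u$ to a neighbor $v$ removes two pebbles from $u$ and adds one to $v$; $C$ is $r$-solvable if some sequence of pebbling steps places a pebble on $r$. $\pi(G,r)$ is the minimum $t$ such that every configuration with $t$ pebbles in total is $r$-solvable, $\pi(G)=\max_r\pi(G,r)$, and $G$ is Class 0 if $\pi(G)=|V(G)|$.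 *)

(* Defs.v *)
From mathcomp Require Import all_boot.

Set Implicit Arguments.
Unset Strict Implicit.
Unset Printing Implicit Defensive.

Section Pebbling.

Variables (V : finType) (e : rel V).

Definition config := {ffun V -> nat}.

Definition config_size (C : config) : nat := \sum_v C v.

(* The truncated subtraction is exact wherever this is used: [pebbling_step]
   requires two pebbles on u. *)
Definition move (u v : V) (C : config) : config :=
  [ffun x => C x - (if x == u then 2 else 0) + (if x == v then 1 else 0)].

Definition pebbling_step : rel config :=
  fun C C' => [exists u, exists v,
     [&& e u v, 2 <= C u & C' == move u v C]].

(* The sequence of steps may be empty, so C is r-solvable as soon as it has a
   pebble on r. *)
Definition solvable (r : V) (C : config) : Prop :=
  exists2 s : seq config, path pebbling_step C s & 0 < last C s r.

Definition all_solvable (r : V) (t : nat) : Prop :=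
  forall C : config, config_size C = t -> solvable r C.

(* pi(G, r) = t. A relation rather than a function, as the minimum need not
   exist when the graph is disconnected. *)
Definition is_rooted_pebbling_number (r : V) (t : nat) : Prop :=
  all_solvable r t /\ forall s, all_solvable r s -> t <= s.

(* pi(G) = n *)
Definition is_pebbling_number (n : nat) : Prop :=
  exists2 p : V -> nat,
    forall r, is_rooted_pebbling_number r (p r) & n = \max_r p r.

Definition class0 : Prop := is_pebbling_number #|V|.

End Pebbling.

Definition R20_adj : seq (seq nat) :=
  [:: [:: 6; 8; 11; 12; 14; 15; 16; 17];
      [:: 4; 5; 6; 7; 8; 10; 15; 16; 17; 18; 19; 20];
      [:: 4; 6; 8; 12; 14; 20];
      [:: 2; 3; 5; 6; 8; 9; 12; 15; 18; 19];
      [:: 2; 4; 7; 12; 14; 15; 16; 18; 20];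
      [:: 1; 2; 3; 4; 7; 8; 14; 15; 19];
      [:: 2; 5; 6; 8; 11; 12; 13; 14; 15; 17; 18];
      [:: 1; 2; 3; 4; 6; 7; 10; 11; 14; 15; 17];
      [:: 4; 10; 11; 13; 14; 17; 19; 20];
      [:: 2; 8; 9; 16; 18; 19; 20];
      [:: 1; 7; 8; 9; 13; 14; 16; 18; 20];
      [:: 1; 3; 4; 5; 7; 13; 16];
      [:: 7; 9; 11; 12; 19; 20];
      [:: 1; 3; 5; 6; 7; 8; 9; 11; 18];
      [:: 1; 2; 4; 5; 6; 7; 8; 19];
      [:: 1; 2; 5; 10; 11; 12; 18; 20];
      [:: 1; 2; 7; 8; 9; 19];
      [:: 2; 4; 5; 7; 10; 11; 14; 16; 20];
      [:: 2; 4; 6; 9; 10; 13; 15; 17; 20];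
      [:: 2; 3; 5; 9; 10; 11; 13; 16; 18; 19]].

(* The index i : 'I_20 stands for the vertex v_(i+1); the entries of [R20_adj]
   keep the 1-based numbering. *)
Definition R20 : rel 'I_20 :=
  fun i j => j.+1 \in nth [::] R20_adj i.

Lemma all_ord (n : nat) (p : pred nat) :
  all p (iota 0 n) -> forall i : 'I_n, p i.
Proof. by move=> /allP p_n i; apply: p_n; rewrite mem_iota /=. Qed.

Lemma R20_sym : symmetric R20.
Proof.
have H : all (fun i => all (fun j => (j.+1 \in nth [::] R20_adj i) ==
    (i.+1 \in nth [::] R20_adj j)) (iota 0 20)) (iota 0 20) by vm_compute.
by move=> i j; apply/eqP; exact: all_ord (all_ord H i) j.
Qed.

Lemma R20_irrefl : irreflexive R20.
Proof.
have H : all (fun i => i.+1 \notin nth [::] R20_adj i) (iota 0 20)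
  by vm_compute.
by move=> i; apply/negbTE; exact: all_ord H i.
Qed.

Lemma R20_connected (i j : 'I_20) : connect R20 i j.
Proof.
have H : all (fun i => [|| i == 1, 2 \in nth [::] R20_adj i |
    has (fun k => (k.+1 \in nth [::] R20_adj i) &&
      (2 \in nth [::] R20_adj k)) (iota 0 20)]) (iota 0 20) by vm_compute.
pose c : 'I_20 := Ordinal (isT : 1 < 20).
have toc k : connect R20 k c.
  case/or3P: (all_ord H k) => [/eqP kc|kc|/hasP[l]].
  - by rewrite (_ : k = c) ?connect0 //; apply: val_inj.
  - exact: connect1.
  rewrite mem_iota add0n => l20 /andP[kl lc].
  by apply: (connect_trans (y := Ordinal l20)); apply: connect1.
by apply: connect_trans (toc i) _; rewrite (sym_connect_sym R20_sym) toc.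
Qed.

(* Main.v *)
Require Import Defs.
From mathcomp Require Import all_boot.

Set Implicit Arguments.
Unset Strict Implicit.
Unset Printing Implicit Defensive.

(** Fix a root r and give each vertex v a weight w v such that every v of
    positive weight has a neighbour that is r or has weight at least 2 * w v.
    Pushing two pebbles from v to that neighbour then reaches r or does not
    decrease the total weight of the pebbles; so a configuration that cannot
    reach r can be pushed until every weighted vertex has at most one pebble,
    and its weight is at most \sum_v w v (Hurlbert's weight function lemma).
    For each root of R20, two or three such weights add up to at least 4 on
    every other vertex and to less than 4 * 20 overall, so no configuration of
    20 pebbles is unsolvable. Conversely, at most one pebble on each vertex
    other than r allows no move at all, hence 19 pebbles do not suffice. *)

Section WeightFunctions.

Variables (V : finType) (e : rel V).

(** The lost [2 * f u] is added back on the left, so that no truncated subtraction occurs. *)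
Lemma sum_move (f : V -> nat) (C : config V) (u v : V) : 2 <= C u ->
  \sum_x f x * move u v C x + 2 * f u = \sum_x f x * C x + f v.
Proof.
move=> Cu.
have pick1 (y : V) c : \sum_x f x * (if x == y then c else 0) = c * f y.
  rewrite (bigD1 y) //= eqxx big1 ?addn0 1?mulnC // => x /negPf ->.
  by rewrite muln0.
rewrite -[f v in RHS]mul1n -(pick1 u) -(pick1 v) -!big_split /=.
apply: eq_bigr => x _; rewrite ffunE -!mulnDr addnAC subnK //.
by case: eqP => // ->.
Qed.

(** Weights at least double from a vertex to its chosen neighbour, so by finiteness every chain of
    such neighbours ends at [r]. *)
Definition is_weight (r : V) (w : V -> nat) : Prop :=
  forall v, 0 < w v -> exists2 u, e v u & (u == r) || (2 * w v <= w u).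

Lemma weight_solvable (r : V) (w : V -> nat) (C : config V) :
  is_weight r w -> \sum_v w v < \sum_v w v * C v -> solvable e r C.
Proof.
move=> w_r; have [n] := ubnP (config_size C).
elim: n C => // n IHn C sizeC heavy.
(* If every weighted vertex had at most one pebble, [C] would weigh at most [\sum_v w v], against
   [heavy]. *)
have [v /andP[wv Cv]] : exists v, (0 < w v) && (2 <= C v).
  apply/existsP; apply: contraLR heavy; rewrite negb_exists -leqNgt.
  move=> /forallP few; apply: leq_sum => v _.
  move: (few v); rewrite negb_and -eqn0Ngt -leqNgt => few_v.
  by rewrite -[leqRHS]muln1 leq_mul2l.
have [u evu u_r] := w_r v wv.
have step : pebbling_step e C (move v u C).
  by apply/existsP; exists v; apply/existsP; exists u; rewrite evu Cv eqxx.
case/orP: u_r => [/eqP ur | wvu].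
  exists [:: move v u C]; rewrite /= ?step //.
  by rewrite ffunE ur eqxx addn1.
have [||s path_s last_s] := IHn (move v u C).
(* The constant weight 1 counts pebbles: a move loses exactly one, so the induction on size
   applies. *)
- have := sum_move (fun=> 1) u Cv.
  under eq_bigr do rewrite mul1n; under [in RHS]eq_bigr do rewrite mul1n.
  rewrite -/(config_size _) -/(config_size C) muln1 addn2 addn1 => -[size_eq].
  by rewrite size_eq.
- apply: leq_trans heavy _; rewrite -(leq_add2r (2 * w v)) sum_move //.
  by rewrite leq_add2l.
by exists (move v u C :: s); rewrite //= step.
Qed.

(** Double counting: if [C] exceeds no weight of [s], the weight bounds add up; each of the [t]
    pebbles lies off [r] and contributes at least [k] to the sum. *)
Lemma weights_all_solvable (I : eqType) (s : seq I) (w : I -> V -> nat)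
    (r : V) (k t : nat) :
  {in s, forall i, is_weight r (w i)} ->
  (forall v, v != r -> k <= \sum_(i <- s) w i v) ->
  \sum_(i <- s) \sum_v w i v < k * t -> all_solvable e r t.
Proof.
move=> w_r cover small C sizeC.
have [Cr0 | Cr] := posnP (C r); last by exists [::].
have [/hasP[i i_s heavy]|/hasPn light] :=
    boolP (has (fun i => \sum_v w i v < \sum_v w i v * C v) s).
  exact: weight_solvable (w_r i i_s) heavy.
suff: k * t <= \sum_(i <- s) \sum_v w i v by rewrite leqNgt small.
apply: (@leq_trans (\sum_(i <- s) \sum_v w i v * C v)); last first.
  rewrite big_seq [leqRHS]big_seq; apply: leq_sum => i /light.
  by rewrite -leqNgt.
rewrite exchange_big -sizeC big_distrr /=; apply: leq_sum => v _.
rewrite -big_distrl /=.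
have [->|v_r] := eqVneq v r; first by rewrite Cr0 !muln0.
by rewrite leq_mul2r cover ?orbT.
Qed.

Lemma stuck_unsolvable (r : V) (C : config V) :
  (forall v, C v <= 1) -> C r = 0 -> ~ solvable e r C.
Proof.
move=> C1 Cr0 [[|C' s] /=]; first by rewrite Cr0.
by case/andP=> /existsP[u /existsP[v /and3P[_]]]; rewrite ltnNge C1.
Qed.

Lemma all_solvable_geq_card (r : V) (s : nat) : all_solvable e r s -> #|V| <= s.
Proof.
move=> solv; rewrite leqNgt; apply/negP => s_lt.
(* The bad configuration is the indicator of [s] distinct vertices other than [r], of which there
   are [#|V| - 1]. *)
have /card_geqP[vs [vs_uniq vs_size vs_r]] : s <= #|predC1 r|.
  by rewrite cardC1 -ltnS prednK // (leq_ltn_trans _ s_lt).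
pose C : config V := [ffun x => (x \in vs) : nat].
apply: (@stuck_unsolvable r C) (solv C _) => [v||].
- by rewrite ffunE leq_b1.
- by rewrite ffunE; case: (boolP (r \in vs)) => // /vs_r; rewrite !inE eqxx.
- rewrite -vs_size -(card_uniqP vs_uniq) -sum1_card [RHS]big_mkcond.
  by apply: eq_bigr => v _; rewrite ffunE; case: (v \in vs).
Qed.

Lemma class0_all_solvable :
  0 < #|V| -> (forall r, all_solvable e r #|V|) -> class0 e.
Proof.
move=> /card_gt0P[r0 _] solv; exists (fun=> #|V|) => [r|].
  by split=> // s; apply: all_solvable_geq_card.
(* The vertex [r0] is what bounds the maximum from below: over an empty type it would be 0. *)
apply/eqP; rewrite eqn_leq (leq_bigmax r0) /=.
by apply/bigmax_leqP.
Qed.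

End WeightFunctions.

(* Entry r lists the weights used for the root v_(r+1), each as its values at
   v_1, ..., v_20. They were found by simulated annealing. *)
Definition R20_weights : seq (seq (seq nat)) :=
  [:: [:: [:: 0; 2; 2; 2; 2; 4; 2; 4; 2; 2; 4; 0; 2; 4; 4; 0; 0; 2; 2; 2];
       [:: 0; 2; 2; 2; 2; 1; 2; 2; 2; 2; 0; 4; 2; 0; 0; 4; 4; 2; 2; 2]];
      [:: [:: 2; 0; 2; 4; 2; 0; 4; 4; 2; 4; 2; 2; 2; 2; 2; 1; 1; 0; 4; 0];
       [:: 2; 0; 2; 1; 2; 4; 0; 0; 2; 0; 2; 2; 2; 2; 2; 4; 4; 4; 0; 4]];
      [:: [:: 1; 0; 0; 0; 1; 1; 1; 4; 1; 2; 2; 2; 2; 0; 2; 2; 2; 1; 0; 4];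
       [:: 1; 2; 0; 4; 2; 0; 1; 0; 1; 1; 0; 1; 1; 0; 2; 1; 1; 1; 2; 0];
       [:: 2; 2; 0; 0; 1; 4; 2; 0; 2; 1; 2; 1; 1; 4; 1; 1; 1; 2; 2; 1]];
      [:: [:: 2; 1; 2; 0; 4; 0; 2; 4; 4; 2; 2; 1; 2; 2; 0; 2; 2; 1; 2; 2];
       [:: 2; 4; 2; 0; 0; 4; 2; 0; 0; 2; 2; 4; 2; 2; 4; 2; 2; 4; 2; 2]];
      [:: [:: 2; 1; 2; 0; 0; 2; 4; 2; 2; 2; 2; 0; 2; 0; 1; 4; 2; 0; 2; 4];
       [:: 2; 4; 2; 4; 0; 2; 0; 2; 2; 2; 2; 4; 2; 4; 4; 0; 2; 4; 2; 1]];
      [:: [:: 1; 4; 2; 4; 2; 0; 4; 2; 2; 2; 2; 2; 2; 1; 2; 2; 2; 2; 0; 2];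
       [:: 4; 0; 2; 0; 2; 0; 1; 2; 2; 2; 2; 2; 2; 4; 2; 2; 2; 2; 4; 2]];
      [:: [:: 2; 4; 2; 2; 4; 4; 0; 0; 2; 2; 0; 0; 4; 4; 0; 2; 0; 2; 2; 2];
       [:: 2; 1; 2; 2; 0; 0; 0; 4; 2; 2; 4; 4; 1; 0; 4; 2; 4; 2; 2; 2]];
      [:: [:: 4; 1; 0; 4; 2; 1; 4; 0; 2; 4; 0; 2; 2; 4; 0; 2; 2; 2; 2; 2];
       [:: 1; 4; 4; 0; 2; 4; 0; 0; 2; 0; 4; 2; 2; 0; 4; 2; 2; 2; 2; 2]];
      [:: [:: 2; 2; 2; 4; 2; 2; 2; 2; 0; 4; 4; 2; 0; 2; 2; 2; 1; 2; 0; 0];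
       [:: 2; 2; 2; 0; 2; 2; 2; 2; 0; 2; 0; 2; 4; 2; 2; 2; 4; 2; 4; 4]];
      [:: [:: 1; 0; 1; 2; 1; 2; 0; 0; 4; 0; 2; 1; 2; 0; 2; 0; 1; 0; 4; 1];
       [:: 1; 4; 1; 2; 1; 2; 2; 0; 1; 0; 2; 2; 1; 2; 1; 4; 1; 4; 0; 0];
       [:: 2; 0; 2; 0; 2; 0; 2; 4; 0; 0; 0; 1; 2; 2; 1; 0; 2; 0; 0; 4]];
      [:: [:: 4; 2; 2; 2; 2; 2; 2; 1; 2; 2; 0; 2; 4; 4; 2; 0; 2; 4; 2; 0];
       [:: 0; 2; 2; 2; 2; 2; 2; 4; 4; 2; 0; 2; 0; 0; 2; 4; 2; 0; 2; 4]];
      [:: [:: 0; 2; 4; 2; 2; 2; 0; 0; 0; 2; 1; 0; 0; 1; 1; 4; 0; 2; 1; 2];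
       [:: 4; 1; 1; 4; 1; 1; 0; 2; 2; 1; 2; 0; 0; 1; 1; 0; 2; 1; 1; 1];
       [:: 0; 1; 0; 0; 1; 1; 4; 2; 2; 1; 1; 0; 4; 2; 2; 0; 2; 1; 2; 1]];
      [:: [:: 2; 2; 2; 2; 2; 2; 0; 2; 1; 2; 4; 1; 0; 2; 2; 2; 2; 2; 4; 4];
       [:: 2; 2; 2; 2; 2; 2; 4; 2; 4; 2; 1; 4; 0; 2; 2; 2; 2; 2; 0; 0]];
      [:: [:: 4; 2; 0; 2; 1; 1; 4; 0; 4; 2; 0; 2; 2; 0; 2; 2; 2; 1; 2; 2];
       [:: 0; 2; 4; 2; 4; 4; 0; 4; 0; 2; 4; 2; 2; 0; 2; 2; 2; 4; 2; 2]];
      [:: [:: 0; 4; 2; 4; 0; 0; 4; 4; 2; 2; 2; 2; 2; 2; 0; 2; 2; 2; 0; 2];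
       [:: 4; 0; 2; 2; 4; 4; 0; 1; 2; 2; 2; 2; 2; 2; 0; 2; 2; 2; 4; 2]];
      [:: [:: 4; 0; 2; 2; 1; 2; 2; 2; 2; 4; 2; 4; 2; 2; 2; 0; 2; 4; 2; 0];
       [:: 0; 4; 2; 2; 4; 2; 2; 2; 2; 0; 4; 0; 2; 2; 2; 0; 2; 0; 2; 4]];
      [:: [:: 0; 1; 1; 2; 1; 0; 0; 0; 4; 1; 2; 1; 1; 1; 1; 1; 0; 1; 4; 1];
       [:: 0; 1; 2; 0; 2; 2; 4; 4; 0; 1; 1; 1; 2; 1; 2; 1; 0; 1; 0; 1];
       [:: 4; 4; 1; 2; 2; 2; 0; 0; 0; 2; 1; 2; 1; 2; 1; 2; 0; 2; 0; 2]];
      [:: [:: 2; 4; 2; 4; 0; 2; 1; 2; 2; 1; 1; 2; 2; 0; 2; 4; 2; 0; 2; 4];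
       [:: 2; 0; 2; 0; 4; 2; 4; 2; 2; 4; 4; 2; 2; 4; 2; 0; 2; 0; 2; 0]];
      [:: [:: 2; 0; 2; 4; 2; 0; 2; 2; 4; 0; 2; 2; 1; 2; 4; 2; 0; 2; 0; 4];
       [:: 2; 4; 2; 1; 2; 4; 2; 2; 0; 4; 2; 2; 4; 2; 0; 2; 4; 2; 0; 1]];
      [:: [:: 2; 4; 2; 2; 4; 2; 2; 2; 2; 2; 4; 2; 0; 2; 2; 1; 2; 4; 0; 0];
       [:: 2; 0; 4; 2; 0; 2; 2; 2; 2; 2; 0; 2; 4; 2; 2; 4; 2; 0; 4; 0]]].

Lemma R20_weightsP (r : 'I_20) :
  {in nth [::] R20_weights r,
    forall w, is_weight R20 r (fun v : 'I_20 => nth 0 w v)}.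
Proof.
(* The condition is checked on plain numbers, where it computes; [all_ord] carries it over to
   ordinals. *)
have H : all (fun r => all (fun w => all (fun v => (nth 0 w v == 0) ||
    has (fun u => (u.+1 \in nth [::] R20_adj v) &&
      ((u == r) || (2 * nth 0 w v <= nth 0 w u))) (iota 0 20)) (iota 0 20))
    (nth [::] R20_weights r)) (iota 0 20) by vm_compute.
move=> w /(allP (all_ord H r)) Hw v; rewrite lt0n => /negPf wv.
have := all_ord Hw v; rewrite wv => /hasP[u].
rewrite mem_iota add0n => u20 /andP[vu u_r].
by exists (Ordinal u20).
Qed.

Lemma R20_weights_cover (r v : 'I_20) : v != r ->
  4 <= \sum_(w <- nth [::] R20_weights r) nth 0 w v.
Proof.
have H : all (fun r => all (fun v => (v == r) ||
    (4 <= sumn [seq nth 0 w v | w <- nth [::] R20_weights r])) (iota 0 20))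
    (iota 0 20) by vm_compute.
move/negPf=> vr; have := all_ord (all_ord H r) v.
by rewrite sumnE big_map val_eqE vr.
Qed.

(** The margin is thin: covering 19 vertices by 4 already costs 76, so each total lies between 76
    and 79. *)
Lemma R20_weights_small (r : 'I_20) :
  \sum_(w <- nth [::] R20_weights r) \sum_(v < 20) nth 0 w v < 4 * 20.
Proof.
have H : all (fun r => sumn [seq sumn [seq nth 0 w v | v <- iota 0 20]
    | w <- nth [::] R20_weights r] < 4 * 20) (iota 0 20) by vm_compute.
have := all_ord H r; rewrite sumnE big_map.
by under eq_bigr do rewrite sumnE big_map -/(index_iota 0 20) big_mkord.
Qed.

Theorem theorem3p8 : class0 R20 /\ is_pebbling_number R20 20.
Proof.
suff R20_class0 : class0 R20.
  by split=> //; move: R20_class0; rewrite /class0 card_ord.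
apply: class0_all_solvable => [|r]; rewrite card_ord //.
exact: weights_all_solvable (@R20_weightsP r) (@R20_weights_cover r)
  (R20_weights_small r).
Qed.
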